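(* Let $\Phi$ be a random dynamical system on a separable Banach space $\mathbb{X}$ over a metric dynamical system $(\Omega,\mathcal{F},P,(\theta_t)_{t\in\mathbb{R}})$, and suppose that $\Phi$ has a random periodic path $Y$ of period $\tau>0$. Let $\mu_s$, $s\in\mathbb{R}$, be the measures on $(\bar\Omega,\bar{\mathcal{F}})=(\Omega\times\mathbb{X},\mathcal{F}\otimes\mathcal{B}(\mathbb{X}))$ given by $\mu_s(A)=\int_\Omega\delta_{Y(s,\omega)}(A_{\theta_s\omega})P(d\omega)$, let $(\bar\Theta_t)_{t\ge0}$ be the skew product, and let $\mathbb{E}[\varphi]=\sup_{s\in[0,\tau)}E_{\mu_s}[\varphi]$ for $\varphi\in L_b(\bar\Omega)$. If $(\bar\Omega,\bar{\mathcal{F}},\mu_s,(\bar\Theta_\tau^n)_{n\ge0})$ is ergodic for some $s\in\mathbb{R}$, then $(\bar\Omega,L_b(\bar\Omega),\mathbb{E},(\bar\Theta_t)_{t\ge0})$ is an ergodic sublinear expectation dynamical system.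
   Context: Metric dynamical system: a probability space $(\Omega,\mathcal{F},P)$ with a jointly measurable map $\theta:\mathbb{R}\times\Omega\to\Omega$ such that $\theta_0=\mathrm{id}$, $\theta_t\circ\theta_s=\theta_{t+s}$ and $\theta_tP=P$ for all $s,t\in\mathbb{R}$. Random dynamical system: a measurable map $\Phi:\mathbb{R}^+\times\Omega\times\mathbb{X}\to\mathbb{X}$ such that, almost surely, $\Phi(0,\omega)=\mathrm{id}$ and $\Phi(t+s,\omega)=\Phi(t,\theta_s\omega)\circ\Phi(s,\omega)$ for all $t,s\ge0$. Random periodic path of period $\tau$: a measurable map $Y:\mathbb{R}\times\Omega\to\mathbb{X}$ such that for almost all $\omega$, $\Phi(t,\theta_s\omega)Y(s,\omega)=Y(t+s,\omega)$ and $Y(s+\tau,\omega)=Y(s,\theta_\tau\omega)$ for all $t\ge0$, $s\in\mathbb{R}$. Skew product: $\bar\Theta_t(\omega,x)=(\theta_t\omega,\Phi(t,\omega)x)$, $t\ge 0$. $A_\omega=\{x:(\omega,x)\in A\}$. It is known that $\mu_{s+\tau}=\mu_s$ and $\bar\Theta_t\mu_s=\mu_{t+s}$ for $t\ge0,s\in\mathbb{R}$. $L_b(\bar\Omega)$ is the set of bounded measurable $\varphi:\bar\Omega\to\mathbb{R}$, and $E_{\mu_s}[\varphi]=\int\varphi\,d\mu_s=\int_\Omega\varphi(\omega,Y(s,\theta_{-s}\omega))P(d\omega)$. A sublinear expectation on a linear space $\mathcal{H}$ of real functions (containing constants and closed under absolute value) is a functional $\mathbb{E}:\mathcal{H}\to\mathbb{R}$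 that is monotone, constant preserving, sub-additive and positively homogeneous. A measurable transformation family $(\theta_t)_{t\ge0}$ preserves $\mathbb{E}$ if $\mathbb{E}[\varphi\circ\theta_t]=\mathbb{E}[\varphi]$ for all $\varphi\in\mathcal{H}$, $t\ge0$. If $(\theta_t)_{t\ge0}$ preserves $\mathbb{E}$, the sublinear expectation dynamical system $(\Omega,\mathcal{H},\mathbb{E},(\theta_t)_{t\ge0})$ is ergodic if for any $B\in\sigma(\mathcal{H})$ with $\theta_t^{-1}B=B$ for all $t\ge0$, $\mathbb{E}[I_B]=0$ or $\mathbb{E}[I_{B^c}]=0$. A (classical) measure preserving system is ergodic if every invariant measurable set has measure $0$ or $1$; here $\bar\Theta_\tau^{-1}A=A$ implies $\mu_s(A)\in\{0,1\}$. *)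

(* Defs.v *)
From HB Require Import structures.
From mathcomp Require Import all_boot all_order all_algebra.
From mathcomp Require Import all_classical all_reals all_analysis.

Set Implicit Arguments.
Unset Strict Implicit.
Unset Printing Implicit Defensive.
Import Order.TTheory GRing.Theory Num.Theory.
Import numFieldNormedType.Exports.

Local Open Scope classical_set_scope.
Local Open Scope ring_scope.

Definition separable (T : topologicalType) : Prop :=
  exists2 D : set T, countable D & dense D.

(* T with its Borel sigma-algebra. *)
Notation borel T := (g_sigma_algebraType (@open T)).

Section random_dynamics.
Context (R : realType) (d : measure_display) (Omega : measurableType d).
Context (P : probability Omega R) (X : completeNormedModType R).
Implicit Types (theta : R -> Omega -> Omega) (Phi : R -> Omega -> X -> X).
Implicit Types (Y : R -> Omega -> X) (tau s t : R).

Record metric_dynamical_system theta : Prop := {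
  mds_measurable : measurable_fun setT
    (fun p : measurableTypeR R * Omega => theta p.1 p.2);
  mds_id : theta 0 = id;
  mds_flow : forall s t, theta t \o theta s = theta (t + s);
  mds_preserving : forall t (A : set Omega), measurable A ->
    pushforward P (theta t) A = P A }.

(* The time domain is R^+: only the values Phi t with 0 <= t are constrained
   or used. *)
Record random_dynamical_system theta Phi : Prop := {
  rds_measurable : measurable_fun
    [set p : measurableTypeR R * (Omega * borel X) | 0 <= (p.1 : R)]
    (fun p => Phi p.1 p.2.1 p.2.2 : borel X);
  rds_cocycle : {ae P, forall w, Phi 0 w = id /\
    forall t s : R, 0 <= t -> 0 <= s ->
      Phi (t + s) w = Phi t (theta s w) \o Phi s w} }.

Record random_periodic_path theta Phi tau Y : Prop := {
  rpp_measurable : measurable_fun setT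
    (fun p : measurableTypeR R * Omega => Y p.1 p.2 : borel X);
  rpp_periodic : {ae P, forall w,
    (forall t s : R, 0 <= t -> Phi t (theta s w) (Y s w) = Y (t + s) w) /\
    (forall s, Y (s + tau) w = Y s (theta tau w))} }.

Definition skew_product theta Phi t (z : Omega * borel X) : Omega * borel X :=
  (theta t z.1, Phi t z.1 z.2).

Definition periodic_measure theta Y s (A : set (Omega * borel X)) : \bar R :=
  (\int[P]_w \d_(Y s w : borel X) (xsection A (theta s w)))%E.

(* The real number E_{mu_s}[phi], for bounded measurable phi. The library
   integral takes an arbitrary set function; here it is applied to
   periodic_measure, which is a probability measure as soon as theta and Y are
   jointly measurable. *)
Definition periodic_expectation theta Y s (phi : Omega * borel X -> R) : R :=
  fine (\int[periodic_measure theta Y s]_z (phi z)%:E)%E.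

Definition upper_expectation theta Y tau (phi : Omega * borel X -> R) : R :=
  sup [set periodic_expectation theta Y s phi | s in `[0, tau[].

End random_dynamics.

Definition bounded_measurable (R : realType) (d : measure_display)
    (T : measurableType d) : set (T -> R) :=
  [set phi | measurable_fun setT (phi : T -> measurableTypeR R) /\
             bounded_fun phi].

(* Ergodicity of the discrete system (f^n)_n; invariance of mu under f is a separate
   property, not required here. *)
Definition ergodic_map (R : realType) (d : measure_display)
    (T : measurableType d) (mu : set T -> \bar R) (f : T -> T) : Prop :=
  forall A : set T, measurable A -> f @^-1` A = A ->
    mu A = 0%E \/ mu A = 1%E.

Section sublinear_dynamics.
Context (R : realType) (T : Type).
Implicit Types (H : set (T -> R)) (E : (T -> R) -> R) (theta : R -> T -> T).

Record function_space H : Prop := {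
  fs_cst : forall c : R, H (cst c);
  fs_linear : forall (a : R) (phi psi : T -> R), H phi -> H psi ->
    H (fun x => a * phi x + psi x);
  fs_abs : forall phi : T -> R, H phi -> H (fun x => `|phi x|) }.

(* E is a total function, but only its values on H matter. *)
Record sublinear_expectation H E : Prop := {
  se_space : function_space H;
  se_mono : forall phi psi : T -> R, H phi -> H psi ->
    (forall x, phi x <= psi x) -> E phi <= E psi;
  se_cst : forall c : R, E (cst c) = c;
  se_subadd : forall phi psi : T -> R, H phi -> H psi ->
    E (fun x => phi x + psi x) <= E phi + E psi;
  se_homo : forall (a : R) (phi : T -> R), 0 <= a -> H phi ->
    E (fun x => a * phi x) = a * E phi }.

Definition sigma_of H : set (set T) :=
  <<s \bigcup_(phi in H)
        preimage_set_system setT phi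
          (measurable : set (set (measurableTypeR R))) >>.

Record sublinear_dynamical_system H E theta : Prop := {
  sds_expectation : sublinear_expectation H E;
  sds_measurable : forall t : R, 0 <= t ->
    forall B : set T, sigma_of H B -> sigma_of H (theta t @^-1` B);
  sds_stable : forall (t : R) (phi : T -> R), 0 <= t -> H phi ->
    H (phi \o theta t);
  sds_preserving : forall (t : R) (phi : T -> R), 0 <= t -> H phi ->
    E (phi \o theta t) = E phi }.

(* Meaningful when H contains the indicators of the sets in sigma_of H, as
   bounded_measurable does. *)
Record ergodic_sublinear_system H E theta : Prop := {
  ess_system : sublinear_dynamical_system H E theta;
  ess_ergodic : forall B : set T, sigma_of H B ->
    (forall t : R, 0 <= t -> theta t @^-1` B = B) ->
    E \1_B = 0 \/ E \1_(~` B) = 0 }.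

End sublinear_dynamics.

(* Main.v *)
(* mu_s is the law of w |-> (theta_s w, Y(s, w)). The path property turns this
   map at time s into the one at time t + s under the skew product, so
   E_{mu_s}[phi o Theta_t] = E_{mu_(t+s)}[phi]; since theta_tau preserves P,
   s |-> E_{mu_s}[phi] is tau-periodic, and a supremum over one period is
   invariant under shifts of s. If B is invariant under the skew product, then
   mu_s(B) does not depend on s, so the ergodicity of a single mu_s forces
   mu_s(B) = 0 for all s or mu_s(B) = 1 for all s. *)
Require Import Defs.
From HB Require Import structures.
From mathcomp Require Import all_boot all_order all_algebra.
From mathcomp Require Import all_classical all_reals all_analysis.
From mathcomp Require Import measurable_realfun.

Set Implicit Arguments.
Unset Strict Implicit.
Unset Printing Implicit Defensive.
Import Order.TTheory GRing.Theory Num.Theory.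
Import numFieldNormedType.Exports.

Local Open Scope classical_set_scope.
Local Open Scope ring_scope.

(** * Integration against set functions *)

Section integral_of_set_function.
Context d (T : measurableType d) (R : realType).
Local Open Scope ereal_scope.
Import HBNNSimple.

(* [eq_measure_integral] requires [m1] and [m2] to be measures; here
   [periodic_measure] is only a set function. *)
Lemma eq_set_function_integral (m1 m2 : set T -> \bar R) (f : T -> \bar R) :
  (forall A, measurable A -> m1 A = m2 A) ->
  \int[m1]_x f x = \int[m2]_x f x.
Proof.
move=> m12.
(* The integral is built from [sintegral], which evaluates the set function only on fibres of simple
   functions, and these are measurable. *)
have m12s : forall h : {nnsfun T >-> R}, sintegral m1 h = sintegral m2 h.
  by move=> h; apply: eq_fsbigr => r _; rewrite m12 //; exact: measurable_sfunP.
by rewrite /integral; congr (ereal_sup _ - ereal_sup _);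
  apply: eq_imagel => h _; exact: m12s.
Qed.

End integral_of_set_function.

(** * Periodic functions on the real line *)

Section periodic_functions.
Context (R : realType) (tau : R) (f : R -> R).
Context (tau_gt0 : 0 < tau).
Context (f_periodic : forall s, f (s + tau) = f s).

Lemma periodic_intmul (n : int) (s : R) : f (s + n%:~R * tau) = f s.
Proof.
have fN (k : nat) x : f (x + k%:R * tau) = f x.
  elim: k x => [|k IHk] x; first by rewrite mul0r addr0.
  by rewrite -natr1 mulrDl mul1r addrA f_periodic.
case: n => k; first by rewrite fN.
(* For a negative multiple, the nonnegative case is applied at the shifted point and brings it back
   to [s]. *)
by rewrite NegzE mulrNz mulNr -(fN k.+1 (s - _)) subrK.
Qed.

Lemma periodic_reduction (x : R) :
  x + (- Num.floor (x / tau))%:~R * tau \in `[0, tau[.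
Proof.
have /andP[le_x] := floor_itv (x / tau).
rewrite ltr_pdivrMr// intrD mulrDl mul1r addrC => lt_x.
by rewrite in_itv /= mulrNz mulNr subr_ge0 ltrBlDr -ler_pdivlMr// le_x.
Qed.

Lemma periodic_shift_image (t : R) :
  [set f (t + s) | s in `[0, tau[] = [set f s | s in `[0, tau[].
Proof.
apply/seteqP; split => [_ [s _ <-]|_ [s _ <-]].
  by eexists; [exact: (periodic_reduction (t + s))|exact: periodic_intmul].
(* The time that [t] shifts onto [s] is [s - t], brought back into the period by a multiple of [tau]
   that [f] does not see. *)
eexists; first exact: (periodic_reduction (s - t)).
by rewrite addrA [t + _]addrC subrK periodic_intmul.
Qed.

End periodic_functions.

(** * Bounded measurable functions *)

Section bounded_measurable_functions.
Context (R : realType) (d : measure_display) (T : measurableType d).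
Local Notation Lb := (@bounded_measurable R d T).

Lemma bounded_measurableP (phi : T -> R) : Lb phi <->
  measurable_fun setT phi /\ exists M, forall x, `|phi x| <= M.
Proof.
split=> -[mphi bphi]; split=> //.
  have [M _ phiM] := ex_strict_bound_gt0 bphi.
  by exists M => x; apply/ltW; exact: phiM.
by case: bphi => M phiM; exists M; split=> [|N MN x _];
  [exact: num_real|exact: le_trans (phiM x) (ltW MN)].
Qed.

Lemma bounded_measurable_space : function_space Lb.
Proof.
split.
- by move=> c; apply/bounded_measurableP; split => //; exists `|c|.
- move=> a phi psi /bounded_measurableP[mphi [M phiM]].
  move=> /bounded_measurableP[mpsi [N psiN]]; apply/bounded_measurableP; split.
    by apply: measurable_funD => //; exact: measurable_funM.
  exists (`|a| * M + N) => x; apply: (le_trans (ler_normD _ _)).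
  by rewrite normrM lerD // ler_wpM2l.
- move=> phi /bounded_measurableP[mphi [M phiM]]; apply/bounded_measurableP.
  split; first exact: measurableT_comp.
  by exists M => x; rewrite normr_id.
Qed.

Lemma bounded_measurable_indic (A : set T) : measurable A -> Lb \1_A.
Proof.
move=> mA; apply/bounded_measurableP; split; first exact: measurable_indic.
by exists 1 => x; rewrite ger0_norm ?indic_ge0 // indicE lern1 leq_b1.
Qed.

Lemma bounded_measurable_integrable (P : probability T R) phi :
  Lb phi -> P.-integrable setT (EFin \o phi).
Proof.
move=> [mphi bphi]; apply: measurable_bounded_integrable => //.
exact: (le_lt_trans (probability_le1 P measurableT) (ltry 1)).
Qed.

Lemma sigma_of_bounded_measurable : sigma_of Lb = measurable.
Proof.
apply/seteqP; split.
  apply: smallest_sub; first exact: sigma_algebra_measurable.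
  by move=> _ [phi [mphi _] [B mB <-]]; exact: mphi.
(* A measurable set is the preimage of 1 under its own indicator, which belongs to the function
   space. *)
move=> A mA; apply: sub_sigma_algebra.
exists \1_A; first exact: bounded_measurable_indic.
exists [set 1] => //.
rewrite setTI; apply/seteqP; split=> x /=; rewrite indicE.
  by case: (boolP (x \in A)) => [/set_mem//|_ /esym/eqP]; rewrite oner_eq0.
by move=> /mem_set ->.
Qed.

End bounded_measurable_functions.

Lemma bounded_measurable_comp (R : realType) d (T : measurableType d)
    d' (T' : measurableType d') (g : T' -> T) (phi : T -> R) :
  measurable_fun setT g ->
  bounded_measurable phi -> bounded_measurable (phi \o g).
Proof.
move=> mg /bounded_measurableP[mphi [M phiM]]; apply/bounded_measurableP.
split; first exact: measurableT_comp.
by exists M => x; exact: phiM.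
Qed.

Lemma Rintegral_probability_cst (R : realType) d (T : measurableType d)
  (P : probability T R) (c : R) : \int[P]_w c = c.
Proof.
rewrite Rintegral_cst// [X in fine X](_ : _ = 1%E) ?mulr1//.
exact: probability_setT.
Qed.

Lemma ae_eq_bounded_Rintegral (R : realType) d (T : measurableType d)
    (P : probability T R) (f g : T -> R) :
  bounded_measurable f -> bounded_measurable g ->
  {ae P, forall w, f w = g w} -> \int[P]_w f w = \int[P]_w g w.
Proof.
move=> [mf _] [mg _] fg; congr fine; apply: ae_eq_integral => //.
- exact/measurable_EFinP.
- exact/measurable_EFinP.
- by apply: filterS fg => w fgw _; rewrite /= fgw.
Qed.

(** * Random periodic paths and their laws *)

Section random_periodic.
Context (R : realType) (d : measure_display) (Omega : measurableType d).
Context (P : probability Omega R) (X : completeNormedModType R).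
Context (theta : R -> Omega -> Omega) (Phi : R -> Omega -> X -> X).
Context (tau : R) (Y : R -> Omega -> X).
Context (theta_mds : metric_dynamical_system P theta).
Context (Phi_rds : random_dynamical_system P theta Phi).
Context (tau_gt0 : 0 < tau).
Context (Y_rpp : random_periodic_path P theta Phi tau Y).
Local Notation Lb := (@bounded_measurable R _ (Omega * borel X)%type).
Local Notation Theta := (skew_product theta Phi).
Local Notation Emu := (periodic_expectation P theta Y).

Lemma measurable_flow t : measurable_fun setT (theta t).
Proof. exact: (measurable_fun_pair2 t (mds_measurable theta_mds)). Qed.

Lemma measurable_skew_product t : 0 <= t -> measurable_fun setT (Theta t).
Proof.
move=> t_ge0; apply: measurable_fun_pair.
  by apply: measurableT_comp; [exact: measurable_flow|exact: measurable_fst].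
(* Joint measurability of [Phi] is given on nonnegative times only, so the composition goes through
   this measurable domain, which contains the slice at time [t]. *)
pose D := [set p : measurableTypeR R * (Omega * borel X) | 0 <= (p.1 : R)].
have mD : measurable D.
  have -> : D = fst @^-1` (`[0, +oo[%classic : set (measurableTypeR R)).
    by apply/seteqP; split=> p; rewrite /D /= in_itv/= andbT.
  by rewrite -[X in measurable X]setTI; apply: measurable_fst.
apply: (measurable_comp (g := fun z : Omega * borel X =>
  ((t : measurableTypeR R), z)) mD _ (rds_measurable Phi_rds)).
  by move=> _ [z _ <-].
by apply: measurable_fun_pair; [exact: measurable_cst|exact: measurable_id].
Qed.

Definition path_section s (w : Omega) : Omega * borel X := (theta s w, Y s w).

Lemma measurable_path_section s : measurable_fun setT (path_section s).
Proof.
apply: measurable_fun_pair; first exact: measurable_flow.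
exact: (measurable_fun_pair2 s (rpp_measurable Y_rpp)).
Qed.

Lemma bounded_measurable_path_section s phi : Lb phi ->
  bounded_measurable (phi \o path_section s).
Proof. exact: bounded_measurable_comp (measurable_path_section s). Qed.

(** The Dirac mass of the section of [A] at [theta s w] is the indicator of the event that
    [path_section s w] lies in [A]. *)
Lemma periodic_measureE s (A : set (Omega * borel X)) : measurable A ->
  periodic_measure P theta Y s A = P (path_section s @^-1` A).
Proof.
move=> mA; have mpA : measurable (path_section s @^-1` A).
  by rewrite -[X in measurable X]setTI; exact: measurable_path_section.
transitivity (\int[P]_w (\1_(path_section s @^-1` A) w)%:E)%E; last first.
  by rewrite integral_indic// setIT.
apply: eq_integral => w _; rewrite diracE indicE; congr (_%:R%:E).
by rewrite /xsection; congr (nat_of_bool _); apply/idP/idP; rewrite !inE/= ?inE.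
Qed.

(** Change of variables: the set function agrees on measurable sets with the pushforward of [P], a
    genuine measure. Later estimates can then use linearity and monotonicity of integrals over
    [P]. *)
Lemma periodic_expectationE s phi : Lb phi ->
  Emu s phi = \int[P]_w phi (path_section s w).
Proof.
move=> Lphi; have mpath := measurable_path_section s.
congr fine.
rewrite (eq_set_function_integral (m2 := pushforward P (path_section s))).
  rewrite integral_pushforward//.
  - by apply/measurable_EFinP; case: Lphi.
  - apply: (@bounded_measurable_integrable _ _ _ P).
    exact: bounded_measurable_path_section.
by move=> A mA; exact: periodic_measureE.
Qed.

Lemma periodic_expectation_skew s t phi : 0 <= t -> Lb phi ->
  Emu s (phi \o Theta t) = Emu (t + s) phi.
Proof.
move=> t_ge0 Lphi.
have LphiT := bounded_measurable_comp (measurable_skew_product t_ge0) Lphi.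
rewrite !periodic_expectationE//; apply: ae_eq_bounded_Rintegral.
- exact: (bounded_measurable_path_section s LphiT).
- exact: bounded_measurable_path_section.
apply: filterS (rpp_periodic Y_rpp) => w [Yw _].
by rewrite /= /skew_product /path_section /= Yw// -(mds_flow theta_mds).
Qed.

(** Almost surely the path section at time [s + tau] is the one at time [s] evaluated at
    [theta tau w], and [theta tau] preserves [P]. *)
Lemma periodic_expectation_periodic s phi : Lb phi ->
  Emu (s + tau) phi = Emu s phi.
Proof.
move=> Lphi; rewrite !periodic_expectationE//.
have Lphis := bounded_measurable_path_section s Lphi.
have mtau := measurable_flow tau.
have Lphist := bounded_measurable_comp mtau Lphis.
transitivity (\int[P]_w phi (path_section s (theta tau w))).
  apply: ae_eq_bounded_Rintegral => //.
    exact: bounded_measurable_path_section.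
  apply: filterS (rpp_periodic Y_rpp) => w [_ Yw].
  by rewrite /path_section Yw -(mds_flow theta_mds).
congr fine; pose phis w := (phi (path_section s w))%:E.
rewrite -[LHS](@integral_pushforward _ _ _ _ _ _ mtau P setT phis)//.
- by apply: eq_set_function_integral => A mA; exact: (mds_preserving theta_mds).
- by apply/measurable_EFinP; case: Lphis.
- exact: bounded_measurable_integrable Lphist.
Qed.

(** * The upper expectation: invariance and sublinearity *)

Lemma upper_expectation_skew t phi : 0 <= t -> Lb phi ->
  upper_expectation P theta Y tau (phi \o Theta t) =
  upper_expectation P theta Y tau phi.
Proof.
move=> t_ge0 Lphi; rewrite /upper_expectation.
have Ephi s := periodic_expectation_periodic s Lphi.
rewrite -(periodic_shift_image tau_gt0 Ephi t); congr sup.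
by apply: eq_imagel => s _; exact: periodic_expectation_skew.
Qed.

(** Ensures that [sup] is a true supremum and not its default value: time 0 lies in the period
    because [tau] is positive, and a bound of [phi] bounds every expectation since [P] has mass
    1. *)
Lemma has_sup_periodic_expectation phi : Lb phi ->
  has_sup [set Emu s phi | s in `[0, tau[].
Proof.
move=> Lphi; split.
  by exists (Emu 0 phi), 0 => //=; rewrite in_itv /= lexx.
have /bounded_measurableP[_ [M phiM]] := Lphi; exists M => _ [s _ <-].
have Lphis := bounded_measurable_path_section s Lphi.
rewrite periodic_expectationE//.
apply: (@le_trans _ _ (\int[P]_w M)); last first.
  by rewrite Rintegral_probability_cst.
apply: le_Rintegral => //.
- exact: bounded_measurable_integrable.
- exact: finite_measure_integrable_cst.
- by move=> w _; exact: le_trans (ler_norm _) (phiM _).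
Qed.

Lemma upper_expectation_ub phi s : Lb phi -> 0 <= s < tau ->
  Emu s phi <= upper_expectation P theta Y tau phi.
Proof.
move=> Lphi sI; apply: (ub_le_sup (has_sup_periodic_expectation Lphi).2).
by exists s => //=; rewrite in_itv.
Qed.

Lemma upper_expectation_le phi M : Lb phi ->
  (forall s, 0 <= s < tau -> Emu s phi <= M) ->
  upper_expectation P theta Y tau phi <= M.
Proof.
move=> Lphi EM; apply: (ge_sup (has_sup_periodic_expectation Lphi).1).
by move=> _ [s sI <-]; apply: EM; move: sI; rewrite /= in_itv.
Qed.

(** Serves three times: for constant functions, for the scalar 0 in homogeneity, and for invariant
    null sets. *)
Lemma upper_expectation_cst phi c : Lb phi -> (forall s, Emu s phi = c) ->
  upper_expectation P theta Y tau phi = c.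
Proof.
move=> Lphi Ec; apply/le_anti/andP; split.
  by apply: upper_expectation_le => // s _; rewrite Ec.
by rewrite -(Ec 0); apply: upper_expectation_ub => //; rewrite lexx.
Qed.

Lemma upper_expectation_sublinear :
  sublinear_expectation Lb (upper_expectation P theta Y tau).
Proof.
have Lspace := @bounded_measurable_space R _ (Omega * borel X)%type.
have LbD (phi psi : Omega * borel X -> R) : Lb phi -> Lb psi ->
    Lb (fun x => phi x + psi x).
  move=> Lphi Lpsi; have := fs_linear Lspace 1 Lphi Lpsi.
  by under eq_fun do rewrite mul1r.
have LbZ (a : R) (phi : Omega * borel X -> R) : Lb phi ->
    Lb (fun x => a * phi x).
  move=> Lphi; have := fs_linear Lspace a Lphi (fs_cst Lspace 0).
  by under eq_fun do rewrite addr0.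
have int_path s phi : Lb phi ->
    P.-integrable setT (EFin \o (phi \o path_section s)).
  move=> Lphi; apply: bounded_measurable_integrable.
  exact: bounded_measurable_path_section.
have EZ s a phi : Lb phi -> Emu s (fun x => a * phi x) = a * Emu s phi.
  move=> Lphi; rewrite !periodic_expectationE//; last exact: LbZ.
  by rewrite RintegralZl//; exact: int_path.
split => //.
- move=> phi psi Lphi Lpsi le_phi_psi; apply: upper_expectation_le => // s sI.
  apply: le_trans (upper_expectation_ub Lpsi sI).
  rewrite !periodic_expectationE//.
  by apply: le_Rintegral => //; exact: int_path.
- move=> c; apply: upper_expectation_cst; first exact: fs_cst.
  move=> s; rewrite periodic_expectationE; last exact: fs_cst.
  by rewrite Rintegral_probability_cst.
- move=> phi psi Lphi Lpsi.
  apply: upper_expectation_le => [|s sI]; first exact: LbD.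
  have ubphi := upper_expectation_ub Lphi sI.
  apply: le_trans (lerD ubphi (upper_expectation_ub Lpsi sI)).
  rewrite !periodic_expectationE//; last exact: LbD.
  by rewrite RintegralD//; exact: int_path.
(* The scalar 0 is treated apart, because one of the two inequalities divides by [a]. *)
- move=> a phi; rewrite le_eqVlt => /predU1P[<-|a_gt0] Lphi.
    rewrite mul0r; apply: upper_expectation_cst => [|s]; first exact: LbZ.
    by rewrite EZ// mul0r.
  apply/le_anti/andP; split.
    apply: upper_expectation_le => [|s sI]; first exact: LbZ.
    by rewrite EZ// ler_pM2l// upper_expectation_ub.
  rewrite -ler_pdivlMl//; apply: upper_expectation_le => // s sI.
  by rewrite ler_pdivlMl// -EZ//; apply: upper_expectation_ub => //; exact: LbZ.
Qed.

Lemma skew_product_system :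
  sublinear_dynamical_system Lb (upper_expectation P theta Y tau) Theta.
Proof.
split.
- exact: upper_expectation_sublinear.
- move=> t t_ge0 B; rewrite sigma_of_bounded_measurable => mB.
  by rewrite -[X in measurable X]setTI; exact: measurable_skew_product.
- move=> t phi t_ge0; apply: bounded_measurable_comp.
  exact: measurable_skew_product.
- by move=> t phi t_ge0 Lphi; exact: upper_expectation_skew.
Qed.

(** Translates between the extended-real measures of the ergodicity hypothesis and the real
    expectations of indicators. *)
Lemma periodic_measure_expectation s (A : set (Omega * borel X)) :
  measurable A -> periodic_measure P theta Y s A = (Emu s \1_A)%:E.
Proof.
move=> mA; rewrite periodic_measureE// periodic_expectationE; last first.
  exact: bounded_measurable_indic.
have mpA : measurable (path_section s @^-1` A).
  by rewrite -[X in measurable X]setTI; exact: measurable_path_section.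
rewrite /Rintegral; have -> : (fun w => (\1_A (path_section s w))%:E : \bar R) =
  (fun w => (\1_(path_section s @^-1` A) w)%:E) by [].
by rewrite integral_indic// setIT fineK// fin_num_measure.
Qed.

(** The indicator of [B] is unchanged by composition with the skew product, which moves the time of
    the law forward. Only forward shifts exist, so the smaller of the two times is moved to the
    larger. *)
Lemma periodic_expectation_invariant (B : set (Omega * borel X)) s s' :
  measurable B -> (forall t, 0 <= t -> Theta t @^-1` B = B) ->
  Emu s \1_B = Emu s' \1_B.
Proof.
move=> mB invB; have L1 := bounded_measurable_indic R mB.
have shift u v : u <= v -> Emu u \1_B = Emu v \1_B.
  move=> uv; have vu_ge0 : 0 <= v - u by rewrite subr_ge0.
  rewrite -[in RHS](subrK u v) -periodic_expectation_skew//; congr (Emu u _).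
  by apply/funext => z; rewrite /= -[in LHS](invB _ vu_ge0).
by case/orP: (le_total s s') => /shift.
Qed.

End random_periodic.

Theorem theorem4p4 (R : realType) (d : measure_display)
    (Omega : measurableType d) (P : probability Omega R)
    (X : completeNormedModType R)
    (theta : R -> Omega -> Omega) (Phi : R -> Omega -> X -> X)
    (tau : R) (Y : R -> Omega -> X)
    (X_separable : separable X)
    (theta_mds : metric_dynamical_system P theta)
    (Phi_rds : random_dynamical_system P theta Phi)
    (tau_gt0 : 0 < tau)
    (Y_rpp : random_periodic_path P theta Phi tau Y)
    (Y_ergodic : exists s : R,
      ergodic_map (periodic_measure P theta Y s)
                  (skew_product theta Phi tau)) :
  ergodic_sublinear_system
    (@bounded_measurable R _ (Omega * borel X)%type)
    (upper_expectation P theta Y tau)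
    (skew_product theta Phi).
Proof.
split; first exact: skew_product_system.
move=> B; rewrite sigma_of_bounded_measurable => mB invB.
(* An invariant set that is null at one time is null at all times. This is applied to [B] or to its
   complement. *)
have constE (A : set (Omega * borel X)) s0 : measurable A ->
    (forall t, 0 <= t -> skew_product theta Phi t @^-1` A = A) ->
    periodic_measure P theta Y s0 A = 0%E ->
    upper_expectation P theta Y tau \1_A = 0.
  move=> mA invA muA0; apply: (upper_expectation_cst theta_mds tau_gt0 Y_rpp).
    exact: bounded_measurable_indic.
  move=> s.
  rewrite (periodic_expectation_invariant theta_mds Phi_rds Y_rpp s s0)//.
  by apply: EFin_inj; rewrite -(periodic_measure_expectation theta_mds Y_rpp).
have [s0 erg] := Y_ergodic.
have [muB0|muB1] := erg B mB (invB tau (ltW tau_gt0)).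
  by left; exact: constE muB0.
(* Preimages commute with complements, so the complement of [B] is invariant too. *)
right; apply: (constE (~` B) s0); first exact: measurableC.
  by move=> t t_ge0; exact: (congr1 (@setC _) (invB t t_ge0)).
have mpB : measurable (path_section theta Y s0 @^-1` B).
  rewrite -[X in measurable X]setTI.
  exact: (measurable_path_section theta_mds Y_rpp).
(* The complement rule is applied to the probability [P] on the pulled-back event, giving measure 1
   - 1. *)
rewrite (periodic_measureE theta_mds Y_rpp); last exact: measurableC.
rewrite preimage_setC probability_setC// -(periodic_measureE theta_mds Y_rpp)//.
by rewrite muB1 subee.
Qed.
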